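(* Let $G$ be a simple graph or a multigraph, with degree constraint function $f$, and let $B(G)$ be its skew-symmetric $\phi\times\phi$ matrix as defined in the context. The function $\mathcal F$, which maps each term $\sigma$ of $\det(B(G))$ to the multiset $F_\sigma$ of edges of $G$ corresponding to $\sigma$, is a surjection from the terms of $\det(B(G))$ onto $$\Phi_2(G)=\{F_1\uplus F_2 : F_1,F_2\text{ are (possibly equal) }f\text{-factors of }G\}.$$ Consequently, $G$ has an $f$-factor if and only if $\det(B(G))\ne0$.
   Context: $G=(V,E)$ is an undirected graph on vertices $V=\{1,\dots,n\}$, loops allowed, where edge $ij$ has multiplicity $\mu(ij)\ge1$ ($\mu\equiv1$ for a simple graph); $f:V\to\mathbb Z_+$ and $\phi=\sum_i f(i)$. An $f$-factor is a subset of the edges (copies being distinct) in which every vertex $i$ has degree exactly $f(i)$, a loop counting twice. $\uplus$ denotes multiset sum. Rows and columns of $B(G)$ are both indexed by pairs $i,r$ with $i\in V$, $0\le r<f(i)$. A tuple $(i,r,j,c)$ is permissible, written $(i,r,j,c)\in\mathbb P$, if either $i<j$, or $i=j$ and $r<\lfloor f(i)/2\rfloor\le\lceil f(i)/2\rceil\le c<f(i)$. With distinct indeterminates $x^{ij,k}_r,y^{ij,k}_c$ for every edge copy ($ij\in E$ with $i\le j$, $1\le k\le\mu(ij)$) and every $r,c$, set $$B(G)_{i,r,j,c}=\begin{cases}\sum_{k=1}^{\mu(ij)}x^{ij,k}_r y^{ij,k}_c & ij\in E,\ (i,r,j,c)\in\mathbb P,\\ -\sum_{k=1}^{\mu(ij)}x^{ji,k}_c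 y^{ji,k}_r & ij\in E,\ (j,c,i,r)\in\mathbb P,\\ 0&\text{otherwise.}\end{cases}$$ $\det(B(G))$ is regarded as a polynomial with integer coefficients in these indeterminates; its terms are the monomials that occur with nonzero coefficient after all cancellations. Each term is a product of $\phi$ variable pairs $x^{ij,k}_ry^{ij,k}_c$, and $F_\sigma$ is the multiset containing the $k$th copy of edge $ij$ once for each such pair in $\sigma$ (equivalently, once for each occurrence, with multiplicity, of a variable $x^{ij,k}_\cdot$ in $\sigma$). *)

(* Defs.v *)
From mathcomp Require Import all_boot all_order all_algebra.
From mathcomp Require Import mpoly.
From mathcomp Require Import finmap multiset.

Set Implicit Arguments.
Unset Strict Implicit.
Unset Printing Implicit Defensive.

Import GRing.Theory.
Local Open Scope mset_scope.
Local Open Scope ring_scope.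

(* [mult G i j] is the number of copies of the edge [ij], and is 0 when there
   is no such edge; loops ([i = j]) are allowed, and simple graphs are the
   case [mult G i j <= 1]. *)
Record multigraph (n : nat) := Multigraph {
  mult : 'I_n -> 'I_n -> nat;
  mult_sym : forall i j, mult i j = mult j i
}.

Section Multigraph.

Variables (n : nat) (G : multigraph n) (f : 'I_n -> nat).

Definition edge (i j : 'I_n) : bool := (0 < mult G i j)%N.

(* Undirected edges are represented by their ordered pair of ends [i <= j];
   [ncopies] vanishes on the other pairs, so that each copy is counted once. *)
Definition ncopies (i j : 'I_n) : nat := if (i <= j)%N then mult G i j else 0%N.

Definition edge_copy : Type := {i : 'I_n & {j : 'I_n & 'I_(ncopies i j)}}.

Definition EdgeCopy (i j : 'I_n) (k : 'I_(ncopies i j)) : edge_copy :=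
  existT _ i (existT _ j k).

Definition src (e : edge_copy) : 'I_n := tag e.
Definition dst (e : edge_copy) : 'I_n := tag (tagged e).

(* The two summands make a loop count twice. *)
Definition degree (F : {set edge_copy}) (v : 'I_n) : nat :=
  (\sum_(e in F) ((src e == v) + (dst e == v)))%N.

Definition is_ffactor (F : {set edge_copy}) : Prop :=
  forall v, degree F v = f v.

Definition mset_of_set (F : {set edge_copy}) : {mset edge_copy} :=
  seq_mset (enum F).

Definition Phi2 (M : {mset edge_copy}) : Prop :=
  exists F1 F2 : {set edge_copy},
    [/\ is_ffactor F1, is_ffactor F2 &
        M = (mset_of_set F1 `+` mset_of_set F2)%mset].

(* The left summand indexes the indeterminates [x^e_r], with [r < f (src e)],
   and the right one the indeterminates [y^e_c], with [c < f (dst e)]. *)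
Definition var : Type :=
  ({e : edge_copy & 'I_(f (src e))} + {e : edge_copy & 'I_(f (dst e))})%type.

Definition xvar (e : edge_copy) (r : 'I_(f (src e))) : var :=
  inl (existT _ e r).
Definition yvar (e : edge_copy) (c : 'I_(f (dst e))) : var :=
  inr (existT _ e c).

(* The polynomial library indexes indeterminates by ['I_N]; we number the
   elements of [var]. *)
Definition nvars : nat := #|{: var}|.

Definition x_ (i j : 'I_n) (k : 'I_(ncopies i j)) (r : 'I_(f i)) :
    {mpoly int[nvars]} :=
  'X_(enum_rank (@xvar (EdgeCopy k) r)).
Definition y_ (i j : 'I_n) (k : 'I_(ncopies i j)) (c : 'I_(f j)) :
    {mpoly int[nvars]} :=
  'X_(enum_rank (@yvar (EdgeCopy k) c)).

Definition permissible (i : 'I_n) (r : 'I_(f i)) (j : 'I_n) (c : 'I_(f j)) :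
    bool :=
  (i < j)%N ||
  [&& i == j, (r < (f i)./2 <= uphalf (f i))%N & (uphalf (f i) <= c < f i)%N].

(* A permissible tuple has [i <= j], hence [ncopies i j = mult G i j] in the
   sums below. *)
Definition Bentry (i : 'I_n) (r : 'I_(f i)) (j : 'I_n) (c : 'I_(f j)) :
    {mpoly int[nvars]} :=
  if edge i j && permissible r c then
    \sum_(k < ncopies i j) x_ k r * y_ k c
  else if edge i j && permissible c r then
    - \sum_(k < ncopies j i) x_ k c * y_ k r
  else 0.

(* Rows and columns are indexed by the pairs [(i, r)] with [r < f i], in
   lexicographic order. *)
Definition Bmx : 'M[{mpoly int[nvars]}]_(\sum_(i < n) f i) :=
  \mxblock_(i < n, j < n) (\matrix_(r < f i, c < f j) Bentry r c).

Definition is_term (s : 'X_{1..nvars}) : bool := s \in msupp (\det Bmx).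

(* [e] is taken once for each occurrence in [s] of some [x^e_r]. *)
Definition Fmset (s : 'X_{1..nvars}) : {mset edge_copy} :=
  [fsfun e in [fset e | e in {: edge_copy}]%fset =>
     (\sum_(r < f (src e)) s (enum_rank (xvar r)))%N].

End Multigraph.

(* Main.v *)
Require Import Defs.
From mathcomp Require Import all_boot all_order all_algebra.
From mathcomp Require Import all_fingroup.
From mathcomp Require Import mpoly.
From mathcomp Require Import finmap multiset.
From mathcomp Require Import zify ring.

(** The determinant of a skew-symmetric matrix over an integral domain is a
    square, [\det B = P * P].  Every term of [\det B] has weight [2 f(v)] at the
    vertex [v], contains as many [x^e] as [y^e], and contains [x^e] at most
    twice; weights being additive over a domain, a term of [P] has weight [f(v)]
    at [v] and contains [x^e] at most once, so it is an [f]-factor, and a term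
    of [\det B] is the sum of two of them.

    Conversely, two [f]-factors can be placed in the slots [(i, r)] so that each
    becomes a perfect matching of the slots and common edges occupy the same
    slots.  The product of the two matchings is a monomial whose expansion terms
    differ by reversing some even cycles alternating between the matchings; this
    does not change the sign, so nothing cancels. *)

Set Implicit Arguments.
Unset Strict Implicit.
Unset Printing Implicit Defensive.

Import Order.TTheory GRing.Theory Num.Theory.
Local Open Scope mset_scope.
Local Open Scope ring_scope.

(** * Skew-symmetric determinants are squares *)

Lemma rank_le1_minor2 (F : fieldType) m n (A : 'M[F]_(m, n)) :
  (\rank A <= 1)%N -> forall i j k l, A i j * A k l = A i l * A k j.
Proof.
move=> rkA i j k l.
have [r [C [R [r1 ->]]]] : exists r (C : 'M_(m, r)) (R : 'M_(r, n)),
    (r <= 1)%N /\ A = C *m R.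
  by exists (\rank A), (col_base A), (row_base A); rewrite mulmx_base.
case: r C R r1 => [|[|//]] C R _; first by rewrite !mxE !big_ord0 !mul0r.
rewrite !mxE !big_ord1; move: (C i 0) (R 0 j) (C k 0) (R 0 l) => a b c d.
by rewrite mulrACA [b * d]mulrC mulrACA.
Qed.

(** If the rank of [A] is one less than its size, the rows of [\adj A] lie in a kernel of dimension
    1. If it is smaller still, a nonzero cofactor would exhibit an invertible submatrix of too large
    a rank, so [\adj A] vanishes. *)
Lemma rank_adj_singular (F : fieldType) n (A : 'M[F]_n) :
  \det A = 0 -> (\rank (\adj A) <= 1)%N.
Proof.
case: n A => [|n] A detA; first by rewrite (leq_trans (rank_leq_row _)).
have [rkA | rkA] := leqP n (\rank A).
  have /mxrankS : (\adj A <= kermx A)%MS.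
    by apply/sub_kermxP; rewrite mul_adj_mx detA raddf0.
  by move=> /leq_trans-> //; rewrite mxrank_ker leq_subLR addn1 ltnS.
rewrite (_ : \adj A = 0) ?mxrank0 //; apply/matrixP => i j; rewrite !mxE /cofactor.
apply/eqP; rewrite mulf_eq0; apply/orP; right; apply: contraTT rkA => det_neq0.
have /mxrank_unit : row' j (col' i A) \in unitmx by rewrite unitmxE unitfE.
rewrite [X in \rank X](_ : _ = row' j 1%:M *m (A *m col' i 1%:M)); last first.
  by rewrite row'Esub col'Esub mul_rowsub_mx mul1mx mulmx_colsub mulmx1.
move=> rk; rewrite -leqNgt (leq_trans _ (mxrankM_maxl A (col' i 1%:M))) //.
by rewrite (leq_trans _ (mxrankM_maxr (row' j 1%:M) _)) // rk.
Qed.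

(** The rank argument needs a field, so the identity is checked in the field of fractions, into
    which [R] embeds. *)
Lemma adj_singular_minor2 (R : idomainType) n (A : 'M[R]_n) : \det A = 0 ->
  forall i j k l, \adj A i j * \adj A k l = \adj A i l * \adj A k j.
Proof.
move=> detA i j k l; apply/eqP; rewrite -tofrac_eq !tofracM; apply/eqP.
have: (\rank (\adj (map_mx (@tofrac R) A)) <= 1)%N.
  by apply: rank_adj_singular; rewrite det_map_mx detA rmorph0.
move=> /rank_le1_minor2/(_ i j k l).
by rewrite -map_mx_adj !mxE.
Qed.

(** Expansion along row 0 and then along column 0 of each minor; the doubly reduced minors are the
    cofactors of the remaining block. *)
Lemma det_bordered (R : comNzRingType) n (A : 'M[R]_(n.+1)) : A 0 0 = 0 ->
  \det A = - \sum_i \sum_j A 0 (lift 0 i) * A (lift 0 j) 0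
                       * \adj (row' 0 (col' 0 A)) i j.
Proof.
move=> A00; rewrite (expand_det_row _ 0) big_ord_recl A00 mul0r add0r -sumrN.
apply: eq_bigr => i _; rewrite /cofactor /=.
case: n A A00 i => [|n] A A00 i; first by case: i.
rewrite (expand_det_col _ 0) !mulr_sumr -sumrN.
apply: eq_bigr => j _; rewrite [in RHS]mxE /cofactor !mxE.
have -> : row' j (col' 0 (row' 0 (col' (lift 0 i) A)))
    = row' j (col' i (row' 0 (col' 0 A))).
  apply/matrixP => u w; rewrite !mxE; congr (A _ _).
  by apply/val_inj; rewrite /= /bump /= !add1n addnS ltnS.
have -> : lift (lift 0 i) 0 = 0 :> 'I_n.+2 by apply/val_inj.
rewrite !add0n !addn0 /bump /= add1n exprS mulN1r mulNr mulrN.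
rewrite exprD.
set a := A 0 _; set b := A _ 0; set D := \det _; set s := _ ^+ i; set t := _ ^+ j.
by ring.
Qed.

Lemma eq_opp_eq0 (R : idomainType) (x : R) : 2%:R != 0 :> R -> x = - x -> x = 0.
Proof.
move=> two_neq0 /eqP; rewrite -subr_eq0 opprK -mulr2n -mulr_natl mulf_eq0.
by rewrite (negbTE two_neq0) => /eqP.
Qed.

(** The root is the Pfaffian up to sign, but only its existence matters, so strong induction on the
    size suffices. In odd size the determinant equals its opposite and the root is 0. *)
Lemma skew_det_square (R : idomainType) n (A : 'M[R]_n) :
  2%:R != 0 :> R -> A^T = - A -> exists p, \det A = p * p.
Proof.
move=> two_neq0; have [m] := ubnP n.
elim: m n A => // m IHm [|[|n]] A; first by move=> _ _; exists 1; rewrite det_mx00 mulr1.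
  move=> _ skA; exists 0.
  have := congr1 (fun B : 'M_1 => B 0 0) skA.
  by rewrite !mxE det_mx11 mulr0; apply: eq_opp_eq0.
rewrite ltnS => n_lt_m skA.
have skE i j : A i j = - A j i.
  by have := congr1 (fun M : 'M_n.+2 => M j i) skA; rewrite !mxE.
have diag0 i : A i i = 0 by apply: eq_opp_eq0.
have [odd_n | even_n] := boolP (odd n).
  exists 0; rewrite mulr0; apply: eq_opp_eq0 => //.
  by rewrite -[LHS]det_tr skA -scaleN1r detZ -signr_odd /= odd_n mulN1r.
set B := row' 0 (col' 0 A).
have skB : B^T = - B by apply/matrixP => i j; rewrite !mxE skE.
have detB : \det B = 0.
  apply: eq_opp_eq0 => //.
  by rewrite -[LHS]det_tr skB -scaleN1r detZ -signr_odd /= even_n mulN1r.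
have symC i j : \adj B i j = \adj B j i.
  have := congr1 (fun M : 'M_n.+1 => M j i) (trmx_adj B).
  by rewrite skB -scaleN1r adjZ /= -signr_odd (negbTE even_n) scale1r mxE.
(* [\adj B] has rank at most 1 and its diagonal entries are squares by induction,
   so it factors as [q i * q j], and bordering turns [\det A] into a square. *)
have minor2 := adj_singular_minor2 detB.
have /fin_all_exists [p pE] i : exists q, \adj B i i = q * q.
  rewrite mxE /cofactor -signr_odd oddD addbb mul1r; apply: IHm => //.
    by rewrite ltnW.
  by apply/matrixP => u w; rewrite !mxE skE.
have [q qE] : exists q : 'I_n.+1 -> R, forall i j, \adj B i j = q i * q j.
  have [i0 i0P | p0] := pickP (fun i => p i != 0); last first.
    exists (fun=> 0) => i j; rewrite mulr0; apply/eqP.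
    rewrite -[_ == 0]orbb -mulf_eq0 [X in _ * X]symC minor2 pE.
    by have /negbFE/eqP -> := p0 i; rewrite mul0r mul0r.
  (* The entry has the same square as [p i0 * p j], so it is this product up to a sign, which [q]
     absorbs separately for each [j]. *)
  have /fin_all_exists [q qE] j : exists q, \adj B i0 j = p i0 * q.
    have /eqP : \adj B i0 j * \adj B i0 j = p i0 * p j * (p i0 * p j).
      by rewrite [X in _ * X]symC minor2 !pE mulrACA.
    by rewrite -!expr2 eqf_sqr => /orP[]/eqP ->;
      [exists (p j) | exists (- p j)]; rewrite ?mulrN.
  exists q => i j; apply: (mulfI (mulf_neq0 i0P i0P)).
  by rewrite -{1}pE minor2 [\adj B i i0]symC !qE mulrACA [q j * _]mulrC.
exists (\sum_i A 0 (lift 0 i) * q i).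
rewrite det_bordered // -sumrN mulr_suml; apply: eq_bigr => i _.
rewrite mulr_sumr -sumrN; apply: eq_bigr => j _.
rewrite qE [A (lift 0 j) 0]skE mulrN mulNr opprK.
by rewrite mulrACA.
Qed.

(** * Weights of monomials *)

Section Weights.
Variables (R : idomainType) (n : nat).
Implicit Types (w : 'I_n -> int) (p q : {mpoly R[n]}).

(** Weights are integers rather than naturals, so that a lower bound for [w] is an upper bound for
    its opposite. *)
Definition wt w (m : 'X_{1..n}) : int := \sum_i w i *+ m i.

Lemma wtD w m1 m2 : wt w (m1 + m2)%MM = wt w m1 + wt w m2.
Proof. by rewrite -big_split; apply: eq_bigr => i _; rewrite mnmDE mulrnDr. Qed.

Lemma wt0 w : wt w 0%MM = 0.
Proof. by rewrite /wt big1 // => i _; rewrite mnm0E. Qed.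

Lemma wtU w i : wt w U_(i)%MM = w i.
Proof.
rewrite /wt (bigD1 i) //= mnm1E eqxx big1 ?addr0 // => j ji.
by rewrite mnm1E eq_sym (negbTE ji).
Qed.

Definition wt_le w d p := forall m, m \in msupp p -> wt w m <= d.

Lemma wt_leD w d p q : wt_le w d p -> wt_le w d q -> wt_le w d (p + q).
Proof. by move=> hp hq m /msuppD_le; rewrite mem_cat => /orP[/hp|/hq]. Qed.

Lemma wt_leN w d p : wt_le w d p -> wt_le w d (- p).
Proof. by move=> hp m; rewrite (perm_mem (msuppN p)) => /hp. Qed.

Lemma wt_le0 w d : wt_le w d 0.
Proof. by move=> m; rewrite msupp0. Qed.

Lemma wt_leM w d e p q : wt_le w d p -> wt_le w e q -> wt_le w (d + e) (p * q).
Proof.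
move=> hp hq m /msuppM_le /allpairsP[[m1 m2] /= [/hp h1 /hq h2 ->]].
by rewrite wtD lerD.
Qed.

Lemma wt_le_sum w d (I : finType) (P : pred I) (F : I -> {mpoly R[n]}) :
  (forall i, P i -> wt_le w d (F i)) -> wt_le w d (\sum_(i | P i) F i).
Proof. by move=> hF; apply: big_ind => //; [apply: wt_le0 | apply: wt_leD]. Qed.

Lemma wt_le1 w : wt_le w 0 1.
Proof. by move=> m; rewrite msupp1 inE => /eqP ->; rewrite wt0. Qed.

Lemma wt_le_prod w (I : finType) (d : I -> int) (F : I -> {mpoly R[n]}) :
  (forall i, wt_le w (d i) (F i)) -> wt_le w (\sum_i d i) (\prod_i F i).
Proof.
move=> hF; apply: (big_rec2 (fun e p => wt_le w e p)); first exact: wt_le1.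
by move=> i e p _; apply: wt_leM.
Qed.

(** A bound that is a row part plus a column part has the same total along every permutation. *)
Lemma wt_le_det w k (M : 'M[{mpoly R[n]}]_k) (r c : 'I_k -> int) :
  (forall a b, wt_le w (r a + c b) (M a b)) ->
  wt_le w (\sum_a r a + \sum_b c b) (\det M).
Proof.
move=> hM; rewrite /determinant; apply: wt_le_sum => s _.
suff hs : wt_le w (\sum_a r a + \sum_b c b) (\prod_i M i (s i)).
  by rewrite -signr_odd; case: odd; rewrite ?mul1r ?mulN1r //; apply: wt_leN.
rewrite [\sum_b c b](reindex_inj (@perm_inj _ s)) -big_split /=.
exact: (wt_le_prod (d := fun a => r a + c (s a))).
Qed.

Lemma wt_le_sqr w d p : wt_le w (d + d) (p * p) -> wt_le w d p.
Proof.
move=> hpp m0 m0p.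
have [m [mp m_max]] :
    exists m, m \in msupp p /\ {in msupp p, forall m', wt w m' <= wt w m}.
  elim: (msupp p) m0 m0p => // m s IHs _ _.
  case: s IHs => [|m' s] IHs.
    by exists m; split=> [|m']; rewrite ?inE // => /eqP ->.
  have [|m1 [m1s m1max]] := IHs m'; first by rewrite inE eqxx.
  have [le | /ltW le] := lerP (wt w m) (wt w m1).
    by exists m1; split=> [|m2]; rewrite inE ?m1s ?orbT // => /predU1P[->|/m1max].
  exists m; split=> [|m2]; rewrite inE ?eqxx // => /predU1P[->//|/m1max le2].
  exact: le_trans le.
apply: (le_trans (m_max _ m0p)); rewrite leNgt; apply/negP => d_lt.
(* The square of the part [q] of maximal weight survives in [p * p]. *)
pose q := \sum_(m' <- msupp p | wt w m' == wt w m) p@_m' *: 'X_[m'].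
pose r := \sum_(m' <- msupp p | wt w m' != wt w m) p@_m' *: 'X_[m'].
have pE : p = q + r by rewrite [LHS]mpolyE (bigID (fun m' => wt w m' == wt w m)).
have q_supp m' : m' \in msupp q -> wt w m' = wt w m.
  rewrite mcoeff_msupp => /eqP hm'; apply/eqP; apply/negPn/negP => nwt; apply: hm'.
  rewrite /q linear_sum /= big1 // => m1 /eqP wm1; rewrite mcoeffZ mcoeffX.
  by case: eqP => [e|_]; rewrite ?mulr0 //; rewrite -e wm1 eqxx in nwt.
have r_le : wt_le w (wt w m - 1) r.
  rewrite /r big_seq_cond; apply: big_ind; [exact: wt_le0 | exact: wt_leD |].
  move=> m1 /andP[m1p wm1] m2 /msuppZ_le; rewrite msuppX inE => /eqP ->.
  by have := m_max _ m1p; move: wm1; lia.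
have q_neq0 : q != 0.
  have rm : r@_m = 0 by apply: memN_msupp_eq0; apply/negP => /r_le; lia.
  move: mp; rewrite mcoeff_msupp {1}pE mcoeffD rm addr0.
  by apply: contraNneq => ->; rewrite mcoeff0.
have [m2 m2q] : exists m2, m2 \in msupp (q * q).
  by exists (mlead (q * q)); rewrite mlead_supp // mulf_neq0.
have wm2 : wt w m2 = wt w m + wt w m.
  have /allpairsP[[u v] /= [/q_supp hu /q_supp hv ->]] := msuppM_le m2q.
  by rewrite wtD hu hv.
(* Here [p * p] is [q * q] plus this sum, whose weights stay strictly below twice the maximum, so it
   cannot cancel [m2]. *)
have rest_le : wt_le w (wt w m + wt w m - 1) (q * r + r * p).
  have p_le : wt_le w (wt w m) p by move=> m1 /m_max.
  have q_le : wt_le w (wt w m) q by move=> m1 /q_supp ->.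
  apply: wt_leD; first by rewrite -addrA; apply: wt_leM.
  by rewrite addrAC; apply: wt_leM.
have : m2 \in msupp (p * p).
  rewrite {1}pE mulrDl {1}pE mulrDr -addrA mcoeff_msupp mcoeffD.
  rewrite [X in _ + X]memN_msupp_eq0 ?addr0 -?mcoeff_msupp //.
  by apply/negP => /rest_le; rewrite wm2; lia.
by move/hpp; rewrite wm2; lia.
Qed.

End Weights.

(** * Signs of the expansion terms *)

Lemma two_involutions_coloring (T : finType) (t1 t2 : T -> T) :
  involutive t1 -> involutive t2 -> (forall a, t1 a != a) -> (forall a, t2 a != a) ->
  exists S : pred T, forall a, S (t1 a) = ~~ S a /\ S (t2 a) = ~~ S a.
Proof.
(* Since [t1] conjugates [h] to its inverse, it permutes the [h]-orbits; a fixed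
   orbit would contain a fixed point of [t1] or [t2], so [S] may compare the
   representatives of the orbits of [a] and [t1 a]. *)
move=> t1K t2K t1n t2n; pose h a := t2 (t1 a).
have h_inj : injective h by move=> a b /(inv_inj t2K)/(inv_inj t1K).
(* Since [h (t1 (h a)) = t1 a], a counterexample for [k.+2] at [a] gives one for [k] at [h a]. The
   base cases 0 and 1 say that [t1] and [t2] have no fixed point. *)
have h_iter k : forall a, iter k h a != t1 a.
  have [m] := ubnP k; elim: m k => // m IHm [|[|k]] km a; rewrite /= ?t2n //.
    by rewrite eq_sym.
  apply: contra (IHm k _ (h a)) => [/eqP hk|]; last by lia.
  rewrite -iterSr; apply/eqP/h_inj.
  by rewrite /h in hk *; rewrite /= hk t1K t2K.
have root_t1 a : froot h a != froot h (t1 a).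
  rewrite (root_connect (fconnect_sym h_inj)); apply/negP => /iter_findex.
  by apply/eqP/h_iter.
have root_h a : froot h (h a) = froot h a.
  by apply/eqP; rewrite (root_connect (fconnect_sym h_inj)) fconnect_sym // fconnect1.
pose r a : nat := enum_rank (froot h a).
have r_t1 a : r a != r (t1 a) by rewrite (inj_eq val_inj) (inj_eq enum_rank_inj).
exists (fun a => (r a < r (t1 a))%N) => a; split.
  by rewrite t1K; move: (r_t1 a); lia.
have -> : r (t2 a) = r (t1 a) by rewrite /r -[in RHS]root_h /h t1K.
have -> : r (t1 (t2 a)) = r a by rewrite /r -[in LHS]root_h /h t1K t2K.
by move: (r_t1 a); lia.
Qed.

(** A pair in [E * bool] is an edge with one of its two ends marked; flipping marks the opposite
    end. *)
Definition flip (E : Type) (q : E * bool) : E * bool := (q.1, ~~ q.2).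

Lemma flipK (E : Type) : involutive (@flip E).
Proof. by case=> e b; rewrite /flip negbK. Qed.

Section PairedCovers.
(** The elements of [T] are slots, and [g1], [g2] are two placements of half-edges. Closure under
    [flip] makes each a perfect matching of the slots, and [g12] puts a half-edge common to both in
    a single slot. *)
Variables (T E : finType) (g1 g2 : T -> E * bool).
Hypotheses (g1_inj : injective g1) (g2_inj : injective g2).
Hypotheses (g1_flip : forall a, exists b, g1 b = flip (g1 a)).
Hypotheses (g2_flip : forall a, exists b, g2 b = flip (g2 a)).
Hypothesis g12 : forall a b, g1 a = g2 b -> a = b.

Let incident a q := q = g1 a \/ q = g2 a.

Let incident_inj a b q : incident a q -> incident b q -> a = b.
Proof. by case=> -> [] => [/g1_inj|/g12|/esym/g12|/g2_inj]. Qed.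

(* An expansion term picks in row [a] a half-edge [c a] placed at [a], and moves
   to the column [s a] where the other half is placed; over its row and its
   column each slot must see exactly the half-edges [g1 a] and [g2 a]. *)
Definition expansion (s : {perm T}) (c : T -> E * bool) := forall a q,
  ((c a == q) + (flip (c ((s^-1)%g a)) == q) = (g1 a == q) + (g2 a == q))%N.

(** The union of the two matchings consists of alternating cycles. Leaving the slots of [S] along
    [g1] and the others along [g2] runs through each cycle in one direction. *)
Lemma expansion_exists : exists s (c : {ffun T -> E * bool}), expansion s c.
Proof.
have [t1 t1E] := fin_all_exists g1_flip; have [t2 t2E] := fin_all_exists g2_flip.
have t1K : involutive t1 by move=> a; apply: g1_inj; rewrite !t1E flipK.
have t2K : involutive t2 by move=> a; apply: g2_inj; rewrite !t2E flipK.
have flip_neq (q : E * bool) : flip q <> q by case: q => e []; rewrite /flip.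
have t1n a : t1 a != a by apply/eqP => ta; apply: (flip_neq (g1 a)); rewrite -t1E ta.
have t2n a : t2 a != a by apply/eqP => ta; apply: (flip_neq (g2 a)); rewrite -t2E ta.
have [S SE] := two_involutions_coloring t1K t2K t1n t2n.
pose p a := if S a then t1 a else t2 a.
pose p' a := if S a then t2 a else t1 a.
have pK : cancel p p'.
  move=> a; rewrite /p'.
  have -> : S (p a) = ~~ S a by rewrite /p; case: (S a) (SE a) => [] [].
  by rewrite /p; case: (S a); rewrite /= ?t1K ?t2K.
have p'K : cancel p' p.
  move=> a; rewrite /p.
  have -> : S (p' a) = ~~ S a by rewrite /p'; case: (S a) (SE a) => [] [].
  by rewrite /p'; case: (S a); rewrite /= ?t1K ?t2K.
exists (perm (can_inj pK)), [ffun a => if S a then g1 a else g2 a] => a q.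
have -> : ((perm (can_inj pK))^-1)%g a = p' a.
  by apply: (canLR (permK _)); rewrite permE p'K.
rewrite !ffunE; have -> : S (p' a) = ~~ S a by rewrite /p'; case: (S a) (SE a) => [] [].
by rewrite /p'; case: (S a); rewrite /= ?t1E ?t2E flipK // addnC.
Qed.

(** The counts in [expansion] express an equality of two multisets of size two. *)
Lemma expansion_cases s c a : expansion s c ->
  (c a = g1 a /\ flip (c ((s^-1)%g a)) = g2 a) \/
  (c a = g2 a /\ flip (c ((s^-1)%g a)) = g1 a).
Proof.
move=> /(_ a); move: (c a) (flip _) (g1 a) (g2 a) => q1 q2 q3 q4 h.
have [q13 | q13] := eqVneq q1 q3.
  left; split=> //; apply/eqP; have := h q4.
  by rewrite q13 eqxx => /addnI; case: (q2 == q4).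
have [q14 | q14] := eqVneq q1 q4; last first.
  by have := h q1; rewrite eqxx ![_ == q1]eq_sym (negbTE q13) (negbTE q14).
right; split=> //; apply/eqP; have := h q3.
by rewrite q14 eqxx [RHS]addnC => /addnI; case: (q2 == q3).
Qed.

Lemma expansion_sign (R : comNzRingType) s s' c c' :
  expansion s c -> expansion s' c' ->
  (-1) ^+ s * \prod_a (if (c a).2 then 1 else -1) =
  (-1) ^+ s' * \prod_a (if (c' a).2 then 1 else -1) :> R.
Proof.
move=> sc sc'; pose sg (q : E * bool) : R := if q.2 then 1 else -1.
have sg_flip q : sg (flip q) = - sg q by case: q => e []; rewrite /sg /= ?opprK.
pose A := [set a | c a != c' a].
have inc a : incident a (c a) by case: (expansion_cases a sc) => -[]; [left | right].
have inc' a : incident a (c' a) by case: (expansion_cases a sc') => -[]; [left | right].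
have incd a : incident (s a) (flip (c a)).
  by case: (expansion_cases (s a) sc); rewrite permK => -[_ ->]; [right | left].
have incd' a : incident (s' a) (flip (c' a)).
  by case: (expansion_cases (s' a) sc'); rewrite permK => -[_ ->]; [right | left].
(* On [A] the permutation [s'] is the inverse of [s], elsewhere they agree. *)
have offA a : a \notin A -> s a = s' a.
  by rewrite inE negbK => /eqP ca; apply: incident_inj (incd a) _; rewrite ca.
have swapA a : a \in A -> c a = flip (c' ((s'^-1)%g a)).
  rewrite inE; case: (expansion_cases a sc') => -[-> ->];
    by case: (expansion_cases a sc) => -[-> _] //; rewrite eqxx.
have s'sA a : a \in A -> s' (s a) = a.
  move=> /swapA ca; rewrite -[RHS](permKV s'); congr (s' _).
  by apply: incident_inj (incd a) _; rewrite ca flipK.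
have c's a : a \in A -> c' (s a) = flip (c a).
  by move=> aA; rewrite [c a]swapA // flipK -{2}(s'sA a aA) permK.
(* If [c] and [c'] agreed at [s a], both placements would have [flip (c a)] at [s a], hence [c a] at
   [a], and [c'] would have no other choice at [a]. *)
have sA a : a \in A -> s a \in A.
  move=> aA; rewrite inE c's //; apply: contraL (aA) => /eqP csa; rewrite inE negbK.
  have g12sa : g1 (s a) = g2 (s a) /\ g1 (s a) = flip (c a).
    by case: (expansion_cases (s a) sc); rewrite permK csa => -[<- <-].
  case: g12sa => g12sa g1sa.
  have [b1 b1E] := g1_flip (s a); have [b2 b2E] := g2_flip (s a).
  rewrite -g12sa g1sa flipK in b2E; rewrite g1sa flipK in b1E.
  have b1a : b1 = a by apply: incident_inj (inc a); left.
  have b2a : b2 = a by apply: incident_inj (inc a); right.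
  rewrite b1a in b1E; rewrite b2a in b2E.
  by case: (expansion_cases a sc') => -[-> _]; apply/eqP; rewrite ?b1E ?b2E.
have sAE : [set s a | a in A] = A.
  apply/eqP; rewrite eqEcard (card_imset _ perm_inj) leqnn andbT.
  by apply/subsetP => _ /imsetP[a aA ->]; apply: sA.
have memsA a : (s a \in A) = (a \in A) by rewrite -{1}sAE (mem_imset _ _ perm_inj).
have reindexA (V : Type) (idx : V) (op : Monoid.com_law idx) (F : T -> V) :
    \big[op/idx]_(a in A) F a = \big[op/idx]_(a in A) F (s a).
  by rewrite (reindex_inj (@perm_inj _ s)); apply: eq_bigl => a; rewrite memsA.
(* Along the cycles of [s] in [A], half-edges of [g1] and [g2] alternate. *)
pose in1 q := [exists a, g1 a == q].
have in1_flip q : in1 (flip q) = in1 q.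
  have in1_f q' : in1 q' -> in1 (flip q').
    move=> /existsP[a /eqP <-]; have [b bE] := g1_flip a.
    by apply/existsP; exists b; rewrite bE.
  by apply/idP/idP => /in1_f; rewrite ?flipK.
have in1A a : a \in A -> in1 (c' a) = ~~ in1 (c a).
  have in1g1 : in1 (g1 a) by apply/existsP; exists a.
  have in1g2 : g1 a != g2 a -> in1 (g2 a) = false.
    move=> g1g2; apply/existsP => -[b /eqP gb]; have ba := g12 gb.
    by rewrite -gb ba eqxx in g1g2.
  rewrite inE; case: (expansion_cases a sc') => -[-> _];
    case: (expansion_cases a sc) => -[-> _]; rewrite ?eqxx //.
    by rewrite eq_sym => /in1g2 ->; rewrite in1g1.
  by move=> /in1g2 ->; rewrite in1g1.
(* On [A], exactly one of [c a] and [c' a] is a half-edge of [g1], while moving along [s] shows that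
   [c] and [c'] use such half-edges equally often. *)
have evenA : ~~ odd #|A|.
  have : (\sum_(a in A) in1 (c a) = \sum_(a in A) in1 (c' a))%N.
    rewrite [RHS]reindexA; apply: eq_bigr => a aA.
    by rewrite c's // in1_flip.
  have : (\sum_(a in A) in1 (c a) + \sum_(a in A) in1 (c' a) = #|A|)%N.
    rewrite -big_split -sum1_card; apply: eq_bigr => a aA.
    by rewrite in1A //; case: (in1 (c a)).
  by move=> <- <-; rewrite addnn odd_double.
have prodE : \prod_a sg (c a) = \prod_a sg (c' a).
  rewrite (bigID (mem A)) [RHS](bigID (mem A)) /=; congr (_ * _); last first.
    by apply: eq_bigr => a; rewrite inE negbK => /eqP ->.
  rewrite [RHS]reindexA; under [RHS]eq_bigr => a aA do rewrite c's // sg_flip.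
  by rewrite prodrN -signr_odd (negbTE evenA) mul1r.
(* Reversing the cycles inside [A] multiplies [s] by the square of a permutation, which preserves
   parity. *)
suff -> : s' = (s * ((restr_perm A s)^-1 * (restr_perm A s)^-1))%g.
  by rewrite !odd_permM addbb addbF; congr (_ * _); apply: prodE.
have sN : s \in ('N(A | 'P))%g by apply/astabsP => a; rewrite /= /aperm memsA.
apply/permP => a; rewrite !permM; have [aA | aA] := boolP (a \in A).
  rewrite -{1}(restr_permE sN aA) permK; apply/esym/(canLR (permK _)).
  have s'a : s' a = (s^-1)%g a.
    by rewrite -{1}(permKV s a) s'sA // -memsA permKV.
  by rewrite s'a restr_permE ?permKV // -memsA permKV.
have out b : b \notin A -> ((restr_perm A s)^-1)%g b = b.
  by apply: out_perm; rewrite perm_onV // restr_perm_on.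
by rewrite !out ?memsA // offA.
Qed.

End PairedCovers.

(** * The entries of B(G) *)

Lemma big_tagged (R : Type) (idx : R) (op : Monoid.com_law idx) (I : finType)
    (J : I -> finType) (F : {i : I & J i} -> R) :
  \big[op/idx]_u F u = \big[op/idx]_i \big[op/idx]_j F (Tagged J (j : J i)).
Proof.
rewrite (sig_big_dep _ _ (fun i (j : J i) => F (Tagged J j))).
by apply: eq_bigr => -[].
Qed.

Lemma big_pair_bool (R : Type) (idx : R) (op : Monoid.com_law idx) (I : finType)
    (F : I * bool -> R) :
  \big[op/idx]_q F q = \big[op/idx]_i op (F (i, true)) (F (i, false)).
Proof.
rewrite (eq_bigr (fun q => F (q.1, q.2))) => [|[]//].
by rewrite -(pair_bigA _ (fun i b => F (i, b))); apply: eq_bigr => i _; rewrite big_bool.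
Qed.

Section Entries.
Variables (n : nat) (G : multigraph n) (f : 'I_n -> nat).

(* [(e, true)] is the end [src e], carrying the indeterminates [x^e], and
   [(e, false)] is the end [dst e], carrying the [y^e]. *)
Definition half_edge : finType := (edge_copy G * bool)%type.
Definition slot : finType := {i : 'I_n & 'I_(f i)}.

Implicit Types (q : half_edge) (t : slot) (e : edge_copy G).

Definition endpoint q : 'I_n := if q.2 then src q.1 else dst q.1.
(** Permissibility of a tuple is separated into one condition per end: the first end of a loop takes
    a low index and the second a high one, while ends of other edges are unrestricted. *)
Definition allowed t q : bool :=
  (tag t == endpoint q) &&
  ((src q.1 == dst q.1) ==>
    (if q.2 then tagged t < (f (tag t))./2 else uphalf (f (tag t)) <= tagged t)%N).

Definition var_half (v : var G f) : half_edge :=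
  match v with inl u => (tag u, true) | inr u => (tag u, false) end.

Definition var_slot (v : var G f) : slot :=
  match v with
  | inl u => Tagged (fun i => 'I_(f i)) (tagged u)
  | inr u => Tagged (fun i => 'I_(f i)) (tagged u)
  end.

(* A single indeterminate when [t] lies at the vertex [endpoint q], and the
   empty monomial otherwise. *)
Definition hvar t q : 'X_{1..nvars G f} :=
  (\sum_(v | (var_half v == q) && (var_slot v == t)) U_(enum_rank v))%MM.

Definition hpoly t q : {mpoly int[nvars G f]} :=
  if allowed t q then 'X_[hvar t q] else 0.

Lemma hvar_src e (r : 'I_(f (src e))) :
  hvar (Tagged (fun i => 'I_(f i)) r) (e, true) = U_(enum_rank (xvar r))%MM.
Proof.
apply: big_pred1 => v; rewrite /=; apply/idP/eqP => [|->]; last by rewrite /= !eqxx.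
case: v => -[e' r'] /=; last by rewrite xpair_eqE andbF.
rewrite xpair_eqE andbT => /andP[/eqP e'e]; subst e'.
by rewrite eq_Tagged /= => /eqP ->.
Qed.

Lemma hvar_dst e (c : 'I_(f (dst e))) :
  hvar (Tagged (fun i => 'I_(f i)) c) (e, false) = U_(enum_rank (yvar c))%MM.
Proof.
apply: big_pred1 => v; rewrite /=; apply/idP/eqP => [|->]; last by rewrite /= !eqxx.
case: v => -[e' r'] /=; first by rewrite xpair_eqE andbF.
rewrite xpair_eqE andbT => /andP[/eqP e'e]; subst e'.
by rewrite eq_Tagged /= => /eqP ->.
Qed.

Definition var_weight (w : half_edge -> slot -> int) (i : 'I_(nvars G f)) : int :=
  w (var_half (enum_val i)) (var_slot (enum_val i)).

Definition hweight (w : half_edge -> slot -> int) (m : 'X_{1..nvars G f}) : int :=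
  wt (var_weight w) m.

Lemma hweight_hvar w t q : allowed t q -> hweight w (hvar t q) = w q t.
Proof.
case: t q => i r [e b] /andP[/= /eqP ti _]; case: b ti => /= ti; subst i.
  by rewrite hvar_src /hweight wtU /var_weight enum_rankK.
by rewrite hvar_dst /hweight wtU /var_weight enum_rankK.
Qed.

Lemma hweight_sum_var w m :
  hweight w m = \sum_v w (var_half v) (var_slot v) *+ m (enum_rank v).
Proof.
rewrite /hweight /wt /var_weight (reindex (@enum_rank (var G f))) /=; last first.
  by exists enum_val => v _; rewrite ?enum_rankK ?enum_valK.
by apply: eq_bigr => v _; rewrite enum_rankK.
Qed.

(** Turns the multiplicity of a copy into a weight, so that the bounds for determinants and square
    roots apply to it. *)
Lemma FmsetE m e : (Fmset m e)%:Z = hweight (fun q _ => (q == (e, true))%:R) m.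
Proof.
rewrite hweight_sum_var fsfunE inE /= big_sumType /= [X in _ + X]big1 ?addr0; last first.
  by case=> e' r _; rewrite xpair_eqE andbF mul0rn.
rewrite big_tagged (bigD1 e) //= [X in _ + X]big1 ?addr0; last first.
  move=> e' e'e; rewrite big1 // => r _.
  by rewrite xpair_eqE (negbTE e'e) mul0rn.
rewrite !eqxx -natz natr_sum; exact: eq_bigr.
Qed.

Lemma sum_copies (i j : 'I_n) (r : 'I_(f i)) (c : 'I_(f j)) :
  \sum_e hpoly (Tagged (fun i => 'I_(f i)) r) (e, true)
         * hpoly (Tagged (fun i => 'I_(f i)) c) (e, false)
  = (\sum_(k < ncopies G i j) x_ k r * y_ k c) *+ permissible r c.
Proof.
rewrite big_tagged (bigD1 i) //= [X in _ + X]big1 ?addr0; last first.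
  move=> i' i'i; rewrite big1 // => e _.
  by rewrite /hpoly {1}/allowed /endpoint /= eq_sym (negbTE i'i) mul0r.
rewrite big_tagged (bigD1 j) //= [X in _ + X]big1 ?addr0; last first.
  move=> j' j'j; rewrite big1 // => e _.
  rewrite /hpoly [X in _ * if X then _ else _]/allowed /endpoint /=.
  by rewrite [j == _]eq_sym (negbTE j'j) mulr0.
rewrite -sumrMnl; apply: eq_bigr => k _.
set e : edge_copy G := Tagged _ _.
(* A copy [k] exists only when [i <= j], since [ncopies] vanishes on the other pairs. *)
have le_ij : (i <= j)%N by have := ltn_ord k; rewrite {2}/ncopies; case: ifP.
rewrite /hpoly (hvar_src (e := e)) (hvar_dst (e := e)) /allowed /endpoint /= !eqxx /=.
have -> : dst e = j by [].
rewrite /permissible; have [i_lt | i_ge] := ltnP i j.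
  by rewrite (_ : (i == j) = false) ?mulr1n //; apply/eqP => ij; rewrite ij ltnn in i_lt.
have ij : i = j by apply/val_inj/eqP; rewrite /= eqn_leq le_ij.
subst j; rewrite eqxx /= ltn_ord andbT [(_ < _ <= _)%N]andb_idr; last by lia.
by case: ifP => _; case: ifP => _; rewrite ?mul0r ?mulr0.
Qed.

Definition sgn_half q : {mpoly int[nvars G f]} := if q.2 then 1 else -1.

(** No tuple is permissible in both directions, so the cases of the definition merge into a single
    signed sum over half-edges. In this form skew-symmetry is the reindexing by [flip]. *)
Lemma BentryE (i j : 'I_n) (r : 'I_(f i)) (c : 'I_(f j)) :
  Bentry G r c = \sum_q sgn_half q * (hpoly (Tagged (fun i => 'I_(f i)) r) q
                           * hpoly (Tagged (fun i => 'I_(f i)) c) (flip q)).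
Proof.
rewrite big_pair_bool big_split /=.
under eq_bigr do rewrite mul1r; rewrite sum_copies.
under eq_bigr do rewrite mulN1r mulrC; rewrite sumrN sum_copies /Bentry.
have [ij | nij] := boolP (edge G i j); last first.
  have no_copy (u v : 'I_n) : ~~ edge G u v -> 'I_(ncopies G u v) -> False.
    rewrite /edge lt0n negbK => /eqP uv k; have := ltn_ord k.
    by rewrite {2}/ncopies uv; case: ifP => _; rewrite ltn0.
  have nji : ~~ edge G j i by rewrite /edge mult_sym.
  rewrite big1 => [|k]; last by case: (no_copy _ _ nij k).
  rewrite big1 => [|k]; last by case: (no_copy _ _ nji k).
  by rewrite !mul0rn subr0.
have excl : ~~ (permissible r c && permissible c r).
  rewrite /permissible -!val_eqE /=; apply/negP.
  by case: (ltngtP i j) => ?; rewrite ?andbF // => /andP[]; lia.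
case rc : (permissible r c) excl; case cr : (permissible c r) => //= _;
  by rewrite ?mulr1n ?mulr0n ?subr0 ?sub0r.
Qed.

Definition slot_of (a : 'I_(\sum_(i < n) f i)) : slot := tagnat.sig a.

Lemma BmxE a b : Bmx G f a b =
  \sum_q sgn_half q * (hpoly (slot_of a) q * hpoly (slot_of b) (flip q)).
Proof. by rewrite mxE mxE BentryE /slot_of !tagnat.sigE12. Qed.

Lemma Bmx_skew : (Bmx G f)^T = - Bmx G f.
Proof.
apply/matrixP => a b; rewrite mxE [in RHS]mxE !BmxE -sumrN.
rewrite (reindex_inj (inv_inj (@flipK _))); apply: eq_bigr => q _.
rewrite flipK [hpoly (slot_of b) _ * _]mulrC -mulNr /sgn_half /=.
by case: q.2; rewrite ?opprK.
Qed.

End Entries.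

(** * Terms give pairs of f-factors *)

(** Right multiplication by a unipotent block matrix clears [W] and leaves [U *m W] in the corner.
    In the block form entries of [U] and [W] stand alone, which permits finer degree bounds. *)
Lemma det_mulmx_block (R : comNzRingType) m k (U : 'M[R]_(m, k)) (W : 'M[R]_(k, m)) :
  \det (U *m W) = \det (block_mx 0 (- U) W 1%:M).
Proof.
have := det_mulmx (block_mx 0 (- U) W 1%:M) (block_mx 1%:M 0 (- W) 1%:M).
rewrite mulmx_block !mulmx0 !mul0mx !mulmx1 !mul1mx !add0r mulNmx mulmxN opprK subrr.
by rewrite det_ublock det_lblock !det1 !mulr1.
Qed.

Section Terms.
Variables (n : nat) (G : multigraph n) (f : 'I_n -> nat).
Local Notation half := (half_edge G).
Local Notation slot := (slot f).
Local Notation B := (Bmx G f).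
Local Notation N := (\sum_(i < n) f i)%N.
Local Notation slot_of := (@slot_of n f).

Lemma wt_le_sgn w d (q : half) (p : {mpoly int[nvars G f]}) :
  wt_le w d p -> wt_le w d (sgn_half f q * p).
Proof. by rewrite /sgn_half; case: q.2; rewrite ?mul1r ?mulN1r //; apply: wt_leN. Qed.

Lemma wt_le_hpoly (w : half -> slot -> int) t q d :
  w q t <= d -> wt_le (var_weight w) d (hpoly t q).
Proof.
move=> le_d m; rewrite /hpoly; case: ifP => [ok|_]; last by rewrite msupp0.
by rewrite msuppX inE => /eqP ->; rewrite -[wt _ _]/(hweight w _) hweight_hvar.
Qed.

Lemma wt_le_detB (w : half -> slot -> int) (r : 'I_N -> int) :
  (forall a b q, w q (slot_of a) + w (flip q) (slot_of b) <= r a + r b) ->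
  wt_le (var_weight w) (\sum_a r a + \sum_a r a) (\det B).
Proof.
move=> hr; apply: wt_le_det => a b; rewrite BmxE; apply: wt_le_sum => q _.
apply: wt_le_sgn => m /(wt_leM (wt_le_hpoly (lexx _)) (wt_le_hpoly (lexx _))) h.
exact: le_trans (hr a b q).
Qed.

(* Write [B = U *m W] with [U] indexed by slots and half-edges: in the block form
   of its determinant, [x^e] occurs in one column of [U] and one row of [W] only. *)
Lemma detB_copies_le (e : edge_copy G) :
  wt_le (var_weight (fun (q : half) (_ : slot) => (q == (e, true))%:R)) (1 + 1) (\det B).
Proof.
pose w (q : half) (t : slot) : int := (q == (e, true))%:R.
pose hf := enum_val : 'I_#|{: half}| -> half.
pose U := \matrix_(a, u) (sgn_half f (hf u) * hpoly (slot_of a) (hf u)).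
pose W := \matrix_(u, b) hpoly (slot_of b) (flip (hf u)).
have -> : B = U *m W.
  apply/matrixP => a b; rewrite BmxE !mxE (reindex hf) /=; last first.
    by exists enum_rank => q _; rewrite /hf ?enum_rankK ?enum_valK.
  by apply: eq_bigr => u _; rewrite !mxE mulrA.
rewrite det_mulmx_block.
(* The row weight marks the row of [W] at [(e, false)], whose flip is [(e, true)]; the column weight
   [c] below marks the column of [U] at [(e, true)]. *)
pose r (a : 'I_(N + #|{: half}|)) : int :=
  if split a is inr u then (flip (hf u) == (e, true))%:R else 0.
pose c (a : 'I_(N + #|{: half}|)) : int :=
  if split a is inr u then (hf u == (e, true))%:R else 0.
have sum_hf (q : half) : \sum_u (hf u == q)%:R = 1 :> int.
  rewrite (bigD1 (enum_rank q)) //= /hf enum_rankK eqxx big1 ?addr0 // => u.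
  by rewrite -(can_eq enum_valK) enum_rankK => /negbTE ->.
have sum_r : \sum_a r a = 1.
  rewrite big_split_ord /= big1 ?add0r => [|a _]; last by rewrite /r (unsplitK (inl a)).
  apply: etrans (sum_hf (e, false)); apply: eq_bigr => u _.
  by rewrite /r (unsplitK (inr u)) (inv_eq (@flipK _)).
have sum_c : \sum_a c a = 1.
  rewrite big_split_ord /= big1 ?add0r => [|a _]; last by rewrite /c (unsplitK (inl a)).
  apply: etrans (sum_hf (e, true)); apply: eq_bigr => u _.
  by rewrite /c (unsplitK (inr u)).
rewrite -[X in wt_le _ (X + _)]sum_r -[X in wt_le _ (_ + X)]sum_c.
apply: wt_le_det => a b; rewrite /r /c.
rewrite -(splitK a) -(splitK b).
case: (split a) (split b) => [a'|u] [b'|u'] /=;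
  rewrite ?(unsplitK (inl _)) ?(unsplitK (inr _)).
- by rewrite block_mxEul mxE; apply: wt_le0.
- rewrite block_mxEur !mxE add0r; apply: wt_leN; apply: wt_le_sgn.
  by apply: (wt_le_hpoly (w := w)).
- by rewrite block_mxEdl !mxE addr0; apply: (wt_le_hpoly (w := w)).
rewrite block_mxEdr mxE.
case: (u == u'); last by rewrite mulr0n; apply: wt_le0.
by rewrite mulr1n => m; rewrite msupp1 inE => /eqP ->; rewrite wt0 addr_ge0.
Qed.

Lemma sum_slots (v : 'I_n) : \sum_a (tag (slot_of a) == v)%:R = (f v)%:R :> int.
Proof.
rewrite (reindex (@tagnat.rank n f)) /=; last first.
  by exists (@tagnat.sig n f) => a _; rewrite ?tagnat.rankK ?tagnat.sigK.
under eq_bigr do rewrite /slot_of tagnat.rankK.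
rewrite big_tagged (bigD1 v) //= eqxx sumr_const card_ord.
by rewrite big1 ?addr0 // => i /negbTE iv; rewrite big1 // => c _; rewrite iv.
Qed.

Definition copy_set (m : 'X_{1..nvars G f}) : {set edge_copy G} :=
  [set e | (0 < Fmset m e)%N].

Lemma sqrt_term_ffactor (P : {mpoly int[nvars G f]}) m :
  \det B = P * P -> m \in msupp P ->
  is_ffactor f (copy_set m) /\ forall e, Fmset m e = (e \in copy_set m).
Proof.
move=> detP mP.
have le_sqrt w d : wt_le (var_weight w) (d + d) (\det B) -> hweight w m <= d.
  by rewrite detP => /wt_le_sqr/(_ _ mP).
have le1 e : (Fmset m e <= 1)%N.
  by rewrite -lez_nat FmsetE; apply: le_sqrt; apply: detB_copies_le.
(* If every entry is homogeneous for [w], the halved bound applies to both [w] and its opposite, and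
   the weight of [m] is exact. *)
have eq_sqrt w (r : 'I_N -> int) d : \sum_a r a = d ->
    (forall a b q, w q (slot_of a) + w (flip q) (slot_of b) = r a + r b) ->
    hweight w m = d.
  move=> sum_r hr; apply/eqP; rewrite eq_le; apply/andP; split.
    by apply: le_sqrt; rewrite -sum_r; apply: wt_le_detB => a b q; rewrite hr.
  rewrite -lerN2 (_ : - hweight w m = hweight (fun q t => - w q t) m); last first.
    by rewrite !hweight_sum_var -sumrN; apply: eq_bigr => v _; rewrite mulNrn.
  apply: le_sqrt; rewrite -sum_r -sumrN.
  apply: (wt_le_detB (w := fun q t => - w q t) (r := fun a => - r a)) => a b q.
  by rewrite -!opprD lerN2 hr.
(* Each entry pairs an [x^e] with a [y^e], so the difference of their counts is a weight that is
   zero on all entries. *)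
have balanced e : hweight (fun q _ => (q == (e, false))%:R) m = (Fmset m e)%:Z.
  apply/eqP; rewrite FmsetE -subr_eq0; apply/eqP.
  pose w (q : half) (_ : slot) : int := (q == (e, false))%:R - (q == (e, true))%:R.
  transitivity (hweight w m).
    by rewrite !hweight_sum_var -sumrB; apply: eq_bigr => v _; rewrite -mulrnBl.
  apply: (eq_sqrt w (fun=> 0)) => [|a a' [e' b]]; first by rewrite big1.
  by rewrite /w /flip !xpair_eqE /=; case: (e' == e); case: b.
have FE e : Fmset m e = (e \in copy_set m).
  by rewrite inE; case: (Fmset m e) (le1 e) => [|[]].
split=> // v; apply/eqP; rewrite -eqz_nat; apply/eqP.
(* Each summand of the entry at [a], [b] has one variable at each of these slots, so the weight
   counts the slots at [v], of which there are [f v]. *)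
transitivity (hweight (fun _ t => (tag t == v)%:R) m); last first.
  by apply: (eq_sqrt _ (fun a => (tag (slot_of a) == v)%:R)) => //; rewrite sum_slots natz.
transitivity (\sum_e (\sum_u (var_half u == (e, true))%:R *+ m (enum_rank u) *+ (src e == v)
    + \sum_u (var_half u == (e, false))%:R *+ m (enum_rank u) *+ (dst e == v)) : int).
  rewrite /degree -natz natr_sum big_mkcond; apply: eq_bigr => e _ /=.
  rewrite !sumrMnl -(hweight_sum_var (fun q _ => (q == (e, true))%:R)).
  rewrite -(hweight_sum_var (fun q _ => (q == (e, false))%:R)) balanced -FmsetE FE.
  by case: (e \in _); [rewrite natrD | rewrite !mul0rn].
rewrite big_split /= exchange_big [X in _ + X]exchange_big -big_split /= hweight_sum_var.
apply: eq_bigr => -[[e r]|[e r]] _ /=.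
  rewrite [X in _ + X]big1 => [|e' _]; last by rewrite xpair_eqE andbF !mul0rn.
  rewrite (bigD1 e) //= eqxx big1 ?addr0 => [|e' e'e]; first by rewrite mulrnAC.
  by rewrite xpair_eqE eq_sym (negbTE e'e) !mul0rn.
rewrite big1 => [|e' _]; last by rewrite xpair_eqE andbF !mul0rn.
rewrite add0r (bigD1 e) //= eqxx big1 ?addr0 => [|e' e'e]; first by rewrite mulrnAC.
by rewrite xpair_eqE eq_sym (negbTE e'e) !mul0rn.
Qed.

Lemma term_Phi2 (s : 'X_{1..nvars G f}) : is_term s -> Phi2 f (Fmset s).
Proof.
have [|P detP] := @skew_det_square {mpoly int[nvars G f]} _ B _ (Bmx_skew G f).
  by rewrite -mpolyC_nat mpolyC_eq0.
rewrite /is_term detP => /msuppM_le/allpairsP[[m1 m2] /= [m1P m2P ->]].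
have [F1 F1E] := sqrt_term_ffactor detP m1P.
have [F2 F2E] := sqrt_term_ffactor detP m2P.
exists (copy_set m1), (copy_set m2); split=> //; apply/msetP => e.
apply/eqP; rewrite -eqz_nat msetE2 !mset_seqE !count_uniq_mem ?enum_uniq // !mem_enum.
by rewrite -F1E -F2E PoszD !FmsetE /hweight wtD.
Qed.
End Terms.

(** * Placing two f-factors in the slots *)

Local Close Scope ring_scope.

Lemma exists_injection (X T : finType) (t0 : T) (A : {set X}) (B : {set T}) :
  #|A| <= #|B| -> exists h : X -> T, {in A &, injective h} /\ {in A, forall x, h x \in B}.
Proof.
move=> leAB; exists (fun x => nth t0 (enum B) (index x (enum A))).
have lt_ix x : x \in A -> index x (enum A) < size (enum B).
  by move=> xA; rewrite -cardE (leq_trans _ leAB) // cardE index_mem mem_enum.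
split=> [x y xA yA /eqP|x xA]; last by rewrite -mem_enum mem_nth ?lt_ix.
rewrite nth_uniq ?enum_uniq ?lt_ix // => /eqP eq_ix.
by rewrite -[x](nth_index x (s := enum A)) ?mem_enum // eq_ix nth_index ?mem_enum.
Qed.

(** The common part of [X1] and [X2] is first injected into [T1 :&: T2]; the rest of each set then
    fills the rest of its target independently. Injectivity on the union is not claimed. *)
Lemma exists_common_bijection (X T : finType) (t0 : T)
    (X1 X2 : {set X}) (T1 T2 : {set T}) :
  #|X1| = #|T1| -> #|X2| = #|T2| -> #|X1 :&: X2| <= #|T1 :&: T2| ->
  exists h : X -> T, [/\ {in X1 &, injective h}, {in X2 &, injective h},
                         h @: X1 = T1 & h @: X2 = T2].
Proof.
move=> card1 card2 /(exists_injection t0)[h0 [h0_inj h0_in]].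
pose C := h0 @: (X1 :&: X2).
have cardC : #|C| = #|X1 :&: X2| by rewrite card_in_imset.
have rest (Y : {set X}) (S : {set T}) :
    #|Y| = #|S| -> C \subset S -> X1 :&: X2 \subset Y ->
    exists h, {in Y :\: (X1 :&: X2) &, injective h}
            /\ {in Y :\: (X1 :&: X2), forall x, h x \in S :\: C}.
  move=> cardYS CS sY; apply: (exists_injection t0).
  by rewrite !cardsD (setIidPr CS) (setIidPr sY) cardC cardYS.
have [||h1 [h1_inj h1_in]] := rest _ _ card1.
- by apply/subsetP => _ /imsetP[x /h0_in + ->]; rewrite inE => /andP[].
- exact: subsetIl.
have [||h2 [h2_inj h2_in]] := rest _ _ card2.
- by apply/subsetP => _ /imsetP[x /h0_in + ->]; rewrite inE => /andP[].
- exact: subsetIr.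
pose h x := if x \in X1 :&: X2 then h0 x else if x \in X1 then h1 x else h2 x.
have glue (Y : {set X}) (S : {set T}) k : #|Y| = #|S| -> C \subset S ->
    {in Y :\: (X1 :&: X2) &, injective k} ->
    {in Y :\: (X1 :&: X2), forall x, k x \in S :\: C} ->
    {in Y, forall x, h x = if x \in X1 :&: X2 then h0 x else k x} ->
    {in Y &, injective h} /\ h @: Y = S.
  move=> cardYS CS k_inj k_in hE.
  have inj : {in Y &, injective h}.
    move=> x y xY yY; rewrite !hE //.
    case: ifP => xI; case: ifP => yI; first exact: h0_inj.
    - move=> xy; have := k_in y; rewrite !inE yY -xy (imset_f h0 xI) /= andbT -in_setI yI.
      by move/(_ isT).
    - move=> xy; have := k_in x; rewrite !inE xY xy (imset_f h0 yI) /= andbT -in_setI xI.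
      by move/(_ isT).
    by apply: k_inj; rewrite in_setD ?xI ?yI.
  split=> //; apply/eqP; rewrite eqEcard card_in_imset // cardYS leqnn andbT.
  apply/subsetP => _ /imsetP[x xY ->]; rewrite hE //; case: ifP => xI.
    by rewrite (subsetP CS) // imset_f.
  by have := k_in x; rewrite in_setD xI xY => /(_ isT); rewrite inE => /andP[].
have [||i1 e1] := glue _ _ h1 card1 _ h1_inj h1_in.
- by apply/subsetP => _ /imsetP[x /h0_in + ->]; rewrite inE => /andP[].
- by move=> x xX1; rewrite /h xX1.
have [||i2 e2] := glue _ _ h2 card2 _ h2_inj h2_in.
- by apply/subsetP => _ /imsetP[x /h0_in + ->]; rewrite inE => /andP[].
- by move=> x xX2; rewrite /h in_setI xX2 andbT; case: (x \in X1).
by exists h.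
Qed.

(** The work is done colour by colour: nestedness makes the common slots of a colour one of the two
    whole classes, large enough for the common elements. Both [g1] and [g2] are sections of one map
    [H] from [X] to [T], whence the last clause. *)
Lemma exists_coloured_bijections (X T K : finType) (X1 X2 : {set X})
    (col : X -> K) (col1 col2 : T -> K) :
  (forall k, \sum_(x in X1) (col x == k) = \sum_t (col1 t == k)) ->
  (forall k, \sum_(x in X2) (col x == k) = \sum_t (col2 t == k)) ->
  (forall k, (forall t, col1 t = k -> col2 t = k) \/
             (forall t, col2 t = k -> col1 t = k)) ->
  exists g1 g2 : T -> X,
    [/\ injective g1 /\ injective g2,
        forall t, g1 t \in X1 /\ col (g1 t) = col1 t,
        forall t, g2 t \in X2 /\ col (g2 t) = col2 t,
        {in X1, forall x, exists t, g1 t = x} /\ {in X2, forall x, exists t, g2 t = x}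
      & forall t t', g1 t = g2 t' -> t = t'].
Proof.
move=> card1 card2 nested.
have cardE (U : finType) (P : pred U) : #|[set x | P x]| = \sum_x (P x : nat).
  by rewrite -sum1dep_card big_mkcond; apply: eq_bigr => x _; case: (P x).
pose Xk (Y : {set X}) k := [set x in Y | col x == k].
pose Tk (colT : T -> K) k := [set t | colT t == k].
have cardk (Y : {set X}) (colT : T -> K) k :
    \sum_(x in Y) (col x == k) = \sum_t (colT t == k) -> #|Xk Y k| = #|Tk colT k|.
  move=> e; rewrite !cardE -e [RHS]big_mkcond; apply: eq_bigr => x _.
  by case: (x \in Y).
(* Without slots there is no default value [t0], but then the counts force [X1] and [X2] to be
   empty. *)
case: (pickP T) => [t0 _ | T0]; last first.
  have g0 : T -> X by move=> t; have := T0 t.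
  have Y0 (Y : {set X}) (colT : T -> K) (x : X) :
      (forall k, \sum_(x in Y) (col x == k) = \sum_t (colT t == k)) ->
      x \in Y -> exists t, g0 t = x.
    move=> /(_ (col x)) /cardk e xY; move: e.
    rewrite [RHS]eq_card0 => [|t]; last by have := T0 t.
    by move/eqP; rewrite cards_eq0 => /eqP/setP/(_ x); rewrite !inE xY eqxx.
  exists g0, g0; split=> //; try by move=> t; have := T0 t.
    by split=> t; have := T0 t.
  by split=> x; [apply: Y0 card1 | apply: Y0 card2].
have /fin_all_exists [h hP] : forall k, exists h : X -> T,
    [/\ {in Xk X1 k &, injective h}, {in Xk X2 k &, injective h},
        h @: Xk X1 k = Tk col1 k & h @: Xk X2 k = Tk col2 k].
  move=> k; apply: exists_common_bijection => //; try exact: cardk.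
  have [sub12 | sub21] := nested k.
    rewrite [Tk _ _ :&: _](setIidPl _); last first.
      by apply/subsetP => t; rewrite !inE => /eqP tk; rewrite (sub12 _ tk).
    rewrite -(cardk X1) // subset_leq_card //.
    by apply/subsetP => x; rewrite !inE => /andP[/andP[-> ->]].
  rewrite [Tk _ _ :&: _](setIidPr _); last first.
    by apply/subsetP => t; rewrite !inE => /eqP tk; rewrite (sub21 _ tk).
  rewrite -(cardk X2) // subset_leq_card //.
  by apply/subsetP => x; rewrite !inE => /andP[_ /andP[-> ->]].
pose H x := h (col x) x.
have comb (Y : {set X}) (colT : T -> K) :
    (forall k, {in Xk Y k &, injective (h k)}) -> (forall k, h k @: Xk Y k = Tk colT k) ->
    exists g : T -> X, [/\ cancel g H, forall t, g t \in Y /\ col (g t) = colT t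
                         & {in Y, forall x, exists t, g t = x}].
  move=> h_inj h_im.
  have colH x : x \in Y -> colT (H x) = col x.
    move=> xY; have : H x \in Tk colT (col x) by rewrite -h_im /H imset_f // !inE xY eqxx.
    by rewrite inE => /eqP.
  have H_inj : {in Y &, injective H}.
    move=> x y xY yY eqH; have colxy : col x = col y by rewrite -!colH // eqH.
    by apply: (h_inj (col x)); rewrite ?inE ?xY ?yY ?colxy ?eqxx // -[RHS]eqH /H colxy.
  have /fin_all_exists [g gP] : forall t, exists x, x \in Y /\ H x = t.
    move=> t; have : t \in Tk colT (colT t) by rewrite inE.
    rewrite -h_im => /imsetP[x]; rewrite !inE => /andP[xY /eqP colx] ->.
    by exists x; rewrite /H colx.
  exists g; split=> [t|t|x xY]; first by case: (gP t).
    by case: (gP t) => gY gt; rewrite -colH // gt.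
  by exists (H x); case: (gP (H x)) => gY gH; apply: H_inj.
have [||g1 [g1K g1P g1_onto]] := comb X1 col1; try by move=> k; case: (hP k).
have [||g2 [g2K g2P g2_onto]] := comb X2 col2; try by move=> k; case: (hP k).
exists g1, g2; split=> //; first by split; apply: can_inj; eassumption.
by move=> t t' e; rewrite -(g1K t) e g2K.
Qed.

Lemma sum_interval m a b : b <= m -> \sum_(c < m) (a <= c < b) = b - a.
Proof.
move=> b_le; rewrite -[b in RHS](minn_idPl b_le); elim: m {b_le} => [|m IHm].
  by rewrite big_ord0 minn0.
by rewrite big_ord_recr /= IHm; case: (ltnP m b); case: (leqP a m); lia.
Qed.

Section Placement.
Variables (n : nat) (G : multigraph n) (f : 'I_n -> nat).
Local Notation half := (half_edge G).
Local Notation slot := (slot f).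

(* At a vertex of degree [v] in a factor with [L] loops there, the loops take the
   rows [c < L] by their first ends and the rows [uphalf v <= c < uphalf v + L] by
   their second ends; these sets grow with [L], and their complement shrinks. *)
Definition slot_kind (L v c : nat) : bool * bool :=
  if c < L then (true, true) else if uphalf v <= c < uphalf v + L then (true, false)
  else (false, false).

Lemma sum_kind L v k : L.*2 <= v ->
  \sum_(c < v) (slot_kind L v c == k) =
  (if k.1 then L else if k.2 then 0 else v - L.*2).
Proof.
move=> L_le; case: k => [[] []] /=.
- rewrite -[RHS]subn0 -(@sum_interval v) //; last by lia.
  apply: eq_bigr => c _; rewrite /slot_kind; case: ifP => // _; by case: ifP.
- rewrite -[RHS](addKn (uphalf v)) -(@sum_interval v) //; last by lia.
  apply: eq_bigr => c _; rewrite /slot_kind; case: ifP => [cL|_]; last by case: ifP.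
  by rewrite (_ : (uphalf v <= c) = false) //; lia.
- by rewrite big1 // => c _; rewrite /slot_kind; case: ifP => // _; case: ifP.
have : \sum_(c < v) ((0 <= c < L) + (uphalf v <= c < uphalf v + L)
    + (slot_kind L v c == (false, false))) = v.
  rewrite -[RHS]card_ord -sum1_card; apply: eq_bigr => c _; rewrite /slot_kind.
  case: ifP => [cL|_]; last by case: ifP.
  by rewrite (_ : (uphalf v <= c) = false) //; lia.
have L_sum : \sum_(c < v) (c < L) = L.
  by rewrite -[RHS]subn0 -(@sum_interval v) //; lia.
rewrite !big_split /= L_sum sum_interval; last by lia.
by move: (\sum_(_ < _) _) => S; lia.
Qed.

Definition loops (F : {set edge_copy G}) v : nat :=
  #|[set e in F | (src e == v) && (dst e == v)]|.
(** The first Boolean marks loops and the second the first end of a loop. It is false off loops, so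
    that all ends of ordinary edges at a vertex share a colour and may be placed freely. *)
Definition colour (q : half) : 'I_n * (bool * bool) :=
  (endpoint q, (src q.1 == dst q.1, (src q.1 == dst q.1) && q.2)).
Definition slot_colour (F : {set edge_copy G}) (t : slot) : 'I_n * (bool * bool) :=
  (tag t, slot_kind (loops F (tag t)) (f (tag t)) (tagged t)).

Lemma colour_count (F : {set edge_copy G}) v k : is_ffactor f F ->
  (loops F v).*2 <= f v /\
  \sum_(q in [set q : half | q.1 \in F]) (colour q == (v, k)) =
  (if k.1 then loops F v else if k.2 then 0 else f v - (loops F v).*2).
Proof.
move=> Ff; rewrite big_mkcond /=.
pose S k := \sum_e ((e \in F) && (colour (e, true) == (v, k)) +
                    ((e \in F) && (colour (e, false) == (v, k)))).
have SE k' : \sum_q (if q \in [set q : half | q.1 \in F]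
                     then colour q == (v, k') : nat else 0) = S k'.
  by rewrite big_pair_bool; apply: eq_bigr => e _; rewrite !inE /=; case: (e \in F).
have loopE b : S (true, b) = loops F v.
  rewrite /loops -sum1dep_card big_mkcond; apply: eq_bigr => e _.
  rewrite /colour /endpoint !xpair_eqE /=; case: (e \in F) => //=.
  have [-> | neq] := eqVneq (src e) (dst e); case: b;
    rewrite /= ?andbT ?andbF ?andbb ?addn0 ?add0n //;
    by case: eqP => // sv; case: eqP => // dv; rewrite sv dv eqxx in neq.
have S0 : S (false, true) = 0.
  apply: big1 => e _; rewrite /colour !xpair_eqE /=.
  by case: (_ == dst e); rewrite !andbF.
have total : S (true, true) + S (true, false) + S (false, true) + S (false, false) = f v.
  rewrite -Ff /degree big_mkcond -!big_split; apply: eq_bigr => e _ /=.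
  rewrite /colour /endpoint !xpair_eqE /=; case: (e \in F) => //=.
  by case: (src e == v); case: (dst e == v); case: (src e == dst e).
rewrite SE; rewrite !loopE S0 in total; split; first by lia.
by case: k => [[] []] /=; rewrite ?loopE //; lia.
Qed.

Lemma slot_colour_count (F : {set edge_copy G}) (k : 'I_n * (bool * bool)) :
  is_ffactor f F ->
  \sum_(q in [set q : half | q.1 \in F]) (colour q == k) = \sum_t (slot_colour F t == k).
Proof.
case: k => v k Ff; have [loops_le ->] := colour_count v k Ff.
rewrite big_tagged (bigD1 v) //= [X in _ + X]big1 ?addn0 => [|i iv]; last first.
  by apply: big1 => c _; rewrite xpair_eqE /= (negbTE iv).
rewrite -(sum_kind _ loops_le); apply: eq_bigr => c _.
by rewrite xpair_eqE eqxx.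
Qed.

(** Loops count twice in the degree, so there are at most [(f v)./2] of them at [v] and their first
    ends fit in the low indices. *)
Lemma slot_colour_allowed (F : {set edge_copy G}) t q :
  is_ffactor f F -> colour q = slot_colour F t -> allowed t q.
Proof.
move=> Ff; have [loops_le _] := colour_count (tag t) (true, true) Ff.
move=> [] endE; rewrite /slot_kind /allowed endE eqxx /=.
case: ifP => [t_lt [-> /= ->]|_].
  by apply: leq_trans t_lt _; rewrite geq_half_double.
by case: ifP => [/andP[t_ge _] [-> /= ->]|_ [->]].
Qed.

Lemma slot_colour_nested (F1 F2 : {set edge_copy G}) k :
  is_ffactor f F1 -> is_ffactor f F2 ->
  (forall t, slot_colour F1 t = k -> slot_colour F2 t = k) \/
  (forall t, slot_colour F2 t = k -> slot_colour F1 t = k).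
Proof.
case: k => v [b c] F1f F2f.
(* The bound on [L'] keeps the indices below [L'] apart from those starting at [uphalf w]. *)
have le_nested L L' w u : L <= L' -> L'.*2 <= w ->
    (b -> slot_kind L w u = (b, c) -> slot_kind L' w u = (b, c)) /\
    (~~ b -> slot_kind L' w u = (b, c) -> slot_kind L w u = (b, c)).
  rewrite /slot_kind => leL L'w; case: b; split=> // _;
    case: ifP; case: ifP => //; case: ifP => //; try case: ifP => //;
    move=> *; exfalso; lia.
have [le1 _] := colour_count v (b, c) F1f.
have [le2 _] := colour_count v (b, c) F2f.
wlog leL : F1 F2 F1f F2f le1 le2 / loops F1 v <= loops F2 v.
  move=> wl; have [/wl|/ltnW/wl] := leqP (loops F1 v) (loops F2 v); first exact.
  by case=> //; [right | left].
have nest := le_nested _ _ _ _ leL le2.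
case: b {le_nested le1 le2} nest => nest; [left | right];
  move=> -[i u] [/= iv kt]; subst i; rewrite /slot_colour /=.
  by have [+ _] := nest u; move=> /(_ isT kt) ->.
by have [_ +] := nest u; move=> /(_ isT kt) ->.
Qed.

Lemma exists_placement (F1 F2 : {set edge_copy G}) :
  is_ffactor f F1 -> is_ffactor f F2 ->
  exists g1 g2 : slot -> half,
    [/\ injective g1 /\ injective g2,
        forall t, g1 t \in [set q : half | q.1 \in F1] /\ allowed t (g1 t),
        forall t, g2 t \in [set q : half | q.1 \in F2] /\ allowed t (g2 t),
        {in [set q : half | q.1 \in F1], forall q, exists t, g1 t = q} /\
        {in [set q : half | q.1 \in F2], forall q, exists t, g2 t = q}
      & forall t t', g1 t = g2 t' -> t = t'].
Proof.
move=> F1f F2f; have [||| g1 [g2 [gi g1P g2P go g12]]] :=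
  @exists_coloured_bijections _ _ _
    [set q : half | q.1 \in F1] [set q : half | q.1 \in F2]
    colour (slot_colour F1) (slot_colour F2).
- by move=> k; apply: slot_colour_count.
- by move=> k; apply: slot_colour_count.
- by move=> k; apply: slot_colour_nested.
exists g1, g2; split=> // t; [case: (g1P t) | case: (g2P t)] => gF col_g.
  by split=> //; apply: slot_colour_allowed col_g.
by split=> //; apply: slot_colour_allowed col_g.
Qed.

End Placement.

Local Open Scope ring_scope.

(** * Pairs of f-factors give terms *)

Section Surjectivity.
Variables (n : nat) (G : multigraph n) (f : 'I_n -> nat).
Local Notation half := (half_edge G).
Local Notation slot := (slot f).
Local Notation B := (Bmx G f).
Local Notation N := (\sum_(i < n) f i)%N.
Local Notation slot_of := (@slot_of n f).
Implicit Types (s : {perm 'I_N}) (c : {ffun 'I_N -> half}).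

(** An expansion term of the determinant is a permutation [s] with a choice [c a] of a summand in
    each entry at [a], [s a]; it vanishes when some chosen half-edge is not allowed in its slot. *)
Definition term_ok s c : bool :=
  [forall a, allowed (slot_of a) (c a) && allowed (slot_of (s a)) (flip (c a))].
Definition term_mon s c : 'X_{1..nvars G f} :=
  (\sum_a (hvar (slot_of a) (c a) + hvar (slot_of (s a)) (flip (c a))))%MM.
Definition term_sign s c : int := (-1) ^+ s * \prod_a (if (c a).2 then 1 else -1).

Lemma mcoeff_detB m :
  (\det B)@_m = \sum_s \sum_c term_sign s c * (term_ok s c && (term_mon s c == m))%:R.
Proof.
rewrite /determinant linear_sum /=; apply: eq_bigr => s _.
rewrite (eq_bigr _ (fun a _ => BmxE G a (s a))).
rewrite bigA_distr_bigA mulr_sumr linear_sum /=; apply: eq_bigr => c _.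
rewrite big_split /= mulrA.
have -> : (-1) ^+ s * \prod_a sgn_half f (c a) = (term_sign s c)%:MP_[nvars G f].
  rewrite /term_sign mpolyCM rmorphXn rmorphN rmorph1 rmorph_prod; congr (_ * _).
  by apply: eq_bigr => a _; rewrite /sgn_half; case: ifP; rewrite ?rmorphN rmorph1.
rewrite mcoeffCM; congr (_ * _).
have [ok | /forallPn[a nok]] := boolP (term_ok s c); last first.
  rewrite (bigD1 a) //= /hpoly; move: nok; rewrite negb_and.
  by case/orP => /negbTE ->; rewrite ?mul0r ?mulr0 ?mul0r mcoeff0.
rewrite (eq_bigr (fun a =>
    'X_[hvar (slot_of a) (c a) + hvar (slot_of (s a)) (flip (c a))])).
  by rewrite -(big_morph _ (mpolyXD _) (mpolyX0 _ _)) mcoeffX.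
move=> a _; have /forallP/(_ a)/andP[ok1 ok2] := ok.
by rewrite /hpoly ok1 ok2 mpolyXD.
Qed.

Lemma hweight_term_mon (w : half -> slot -> int) s c : term_ok s c ->
  hweight w (term_mon s c) =
  \sum_a (w (c a) (slot_of a) + w (flip (c a)) (slot_of (s a))).
Proof.
move=> /forallP ok; rewrite /term_mon.
have hw_sum (F : 'I_N -> 'X_{1..nvars G f}) :
    hweight w (\sum_a F a)%MM = \sum_a hweight w (F a).
  by apply: (big_morph _ (wtD _) (wt0 _)).
rewrite hw_sum; apply: eq_bigr => a _; rewrite /hweight wtD -!/(hweight _ _).
by have /andP[ok1 ok2] := ok a; rewrite !hweight_hvar.
Qed.

Lemma Phi2_term (M : {mset edge_copy G}) : Phi2 f M ->
  exists2 s : 'X_{1..nvars G f}, is_term s & Fmset s = M.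
Proof.
move=> [F1 [F2 [F1f F2f ->]]].
have [h1 [h2 [[h1i h2i] h1P h2P [h1o h2o] h12]]] := exists_placement F1f F2f.
pose g1 a := h1 (slot_of a); pose g2 a := h2 (slot_of a).
have slot_ofK : cancel slot_of (@tagnat.rank n f) by exact: tagnat.sigK.
have rankK : cancel (@tagnat.rank n f) slot_of by exact: tagnat.rankK.
have g1i : injective g1 by move=> a b /h1i /(can_inj slot_ofK).
have g2i : injective g2 by move=> a b /h2i /(can_inj slot_ofK).
have g12 a b : g1 a = g2 b -> a = b by move=> /h12 /(can_inj slot_ofK).
have g1F a : exists b, g1 b = flip (g1 a).
  have [|t tE] := h1o (flip (g1 a)); first by have [] := h1P (slot_of a); rewrite !inE.
  by exists (tagnat.rank t); rewrite /g1 rankK.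
have g2F a : exists b, g2 b = flip (g2 a).
  have [|t tE] := h2o (flip (g2 a)); first by have [] := h2P (slot_of a); rewrite !inE.
  by exists (tagnat.rank t); rewrite /g2 rankK.
have [s0 [c0 exp0]] := expansion_exists g1i g2i g1F g2F.
have ok0 : term_ok s0 c0.
  apply/forallP => a; apply/andP; split.
    case: (expansion_cases a exp0) => -[-> _];
      [by case: (h1P (slot_of a)) | by case: (h2P (slot_of a))].
  case: (expansion_cases (s0 a) exp0); rewrite permK => -[_ ->];
    [by case: (h2P (slot_of (s0 a))) | by case: (h1P (slot_of (s0 a)))].
have count s c a q : term_ok s c ->
    hweight (fun q' t => ((q' == q) && (t == slot_of a))%:R) (term_mon s c)
    = ((c a == q) + (flip (c ((s^-1)%g a)) == q))%:R.
  move=> ok; rewrite hweight_term_mon // big_split natrD /=; congr (_ + _).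
    rewrite (bigD1 a) //= eqxx andbT [X in _ + X]big1 ?addr0 // => b ba.
    by rewrite (can_eq slot_ofK) (negbTE ba) andbF.
  rewrite (bigD1 ((s^-1)%g a)) //= permKV eqxx andbT [X in _ + X]big1 ?addr0 // => b ba.
  by rewrite (can_eq slot_ofK) (canF_eq (permK s)) (negbTE ba) andbF.
exists (term_mon s0 c0).
  rewrite /is_term mcoeff_msupp mcoeff_detB.
  pose good s c := term_ok s c && (term_mon s c == term_mon s0 c0).
  (* The weights in [count] read off from the monomial which half-edges meet each slot, so any term
     with this monomial is an expansion of [g1], [g2] and has the same sign. The coefficient is this
     sign times a positive count. *)
  have signE s c : good s c -> term_sign s c = term_sign s0 c0.
    move=> /andP[ok /eqP monE].
    apply: (@expansion_sign _ _ g1 g2 g1i g2i g1F g2F g12 _ s s0 c c0 _ exp0) => a q.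
    by apply/eqP; rewrite -(eqr_nat int) -count // monE count // exp0.
  rewrite (eq_bigr (fun s => \sum_c term_sign s0 c0 * (good s c)%:R)); last first.
    move=> s _; apply: eq_bigr => c _; rewrite -/(good s c).
    by case: (boolP (good s c)) => [/signE ->|_] //; rewrite !mulr0.
  under eq_bigr do rewrite -mulr_sumr.
  rewrite -mulr_sumr mulf_neq0 //.
    rewrite /term_sign mulf_neq0 ?signr_eq0 //; apply/prodf_neq0 => a _.
    by case: ifP.
  rewrite (bigD1 s0) //= (bigD1 c0) //= {1}/good ok0 eqxx /= gt_eqF //.
  by rewrite -addrA ltr_pwDl // addr_ge0 ?sumr_ge0 // => s _; rewrite sumr_ge0.
apply/msetP => e; apply/eqP; rewrite -eqz_nat FmsetE hweight_term_mon // big_split /=.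
(* Summing the second halves by column instead of by row gathers at each slot its two half-edges,
   which are those of [g1] and [g2]. *)
rewrite [X in _ + X](reindex_inj (@perm_inj _ (s0^-1)%g)) -big_split /=.
rewrite (eq_bigr (fun a => (g1 a == (e, true))%:R + (g2 a == (e, true))%:R)); last first.
  by move=> a _; rewrite -!natrD exp0.
have sum1 (F : {set edge_copy G}) (h : slot -> half) : injective h ->
    (forall t, h t \in [set q : half | q.1 \in F]) ->
    {in [set q : half | q.1 \in F], forall q, exists t, h t = q} ->
    \sum_a (h (slot_of a) == (e, true))%:R = (e \in F)%:R :> int.
  move=> hi hF ho; have [eF | eF] := boolP (e \in F).
    have [|t tE] := ho (e, true); first by rewrite inE.
    rewrite (bigD1 (tagnat.rank t)) //= rankK tE eqxx [X in _ + X]big1 ?addr0 // => a an.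
    rewrite -tE (inj_eq hi) (_ : (slot_of a == t) = false) //.
    by apply: contraNF an => /eqP <-; rewrite slot_ofK.
  apply: big1 => a _; case: eqP => // hE; have := hF (slot_of a).
  by rewrite hE inE (negbTE eF).
rewrite big_split /= (sum1 F1) // => [|t]; last by case: (h1P t).
rewrite (sum1 F2) // => [|t]; last by case: (h2P t).
rewrite msetE2 !mset_seqE !count_uniq_mem ?enum_uniq // !mem_enum PoszD.
by case: (e \in F1); case: (e \in F2).
Qed.

End Surjectivity.

Theorem theorem47 (n : nat) (G : multigraph n) (f : 'I_n -> nat) :
  [/\ forall s : 'X_{1..nvars G f}, is_term s -> Phi2 f (Fmset s),
      forall M : {mset edge_copy G}, Phi2 f M ->
        exists2 s : 'X_{1..nvars G f}, is_term s & Fmset s = M &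
      (exists F : {set edge_copy G}, is_ffactor f F) <-> \det (Bmx G f) <> 0].
Proof.
split; [exact: term_Phi2 | exact: Phi2_term | split].
  move=> [F Ff]; have [|s] := @Phi2_term _ G f (mset_of_set F `+` mset_of_set F)%mset.
    by exists F, F.
  by rewrite /is_term => + _ det0; rewrite det0 msupp0.
move=> /eqP/mlead_supp/term_Phi2[F1 [F2 [F1f _ _]]].
by exists F1.
Qed.
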